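(* For every $\Gamma\cup\{\phi\}\subseteq\mathcal{L}_{\Box\Diamond}$, if $\Gamma\vdash_{\mathsf{IM_{Calc}}}\phi$ then $\Gamma\Vdash^{\mathrm{inm}}\phi$ and $\Gamma\models\phi$.
   Context: Language: fix a countable set $\mathrm{Prop}=\{p_0,p_1,\dots\}$ of proposition letters. $\mathcal{L}_{\Box\Diamond}$ is the set of formulas $\phi ::= p_i \mid \bot \mid \phi\wedge\phi \mid \phi\vee\phi \mid \phi\to\phi \mid \Box\phi \mid \Diamond\phi$; $\neg\phi$ abbreviates $\phi\to\bot$ and $\top$ abbreviates $\neg\bot$. Calculus $\mathsf{IM_{Calc}}$: let $\mathscr{Ax}$ be the set of all substitution instances of a standard axiomatisation of intuitionistic propositional logic together with all substitution instances of $(\Box p\wedge\Diamond\neg p)\to\bot$ and $(\Box\top\to\Diamond p)\to\Diamond p$. $\Gamma\vdash_{\mathsf{IM_{Calc}}}\phi$ means $\Gamma\vdash\phi$ is derivable with the rules: (El) $\Gamma\vdash\phi$ for $\phi\in\Gamma$; (Ax) $\Gamma\vdash\psi$ for $\psi\in\mathscr{Ax}$; (MP) from $\Gamma\vdash\phi$ and $\Gamma\vdash\phi\to\psi$ infer $\Gamma\vdash\psi$; (Mon$_\Box$) from $\emptyset\vdash\phi\to\psi$ infer $\Gamma\vdash\Box\phi\to\Box\psi$; (Mon$_\Diamond$) from $\emptyset\vdash\phi\to\psi$ infer $\Gamma\vdash\Diamond\phi\to\Diamond\psi$ (in the last two, $\Gamma$ arbitrary). Intuitionistic neighbourhood models: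 for a poset $(W,\le)$, an intuitionistic neighbourhood is a partial function $a:W\rightharpoonup\mathcal{P}(W)$ whose domain $\mathrm{dom}(a)$ is an upset. A model is $\mathcal{M}=(W,\le,N,V)$ with $N$ a set of intuitionistic neighbourhoods and $V$ mapping proposition letters to upsets; $N_w=\{a\in N\mid w\in\mathrm{dom}(a)\}$. Truth: $w\Vdash p$ iff $w\in V(p)$; $\bot$ never; $\wedge,\vee$ pointwise; $w\Vdash\phi\to\psi$ iff for all $v\ge w$, $v\Vdash\phi$ implies $v\Vdash\psi$; $w\Vdash\Box\phi$ iff there is $a\in N_w$ such that for all $w'\ge w$ and all $v\in a(w')$, $v\Vdash\phi$; $w\Vdash\Diamond\phi$ iff for all $w'\ge w$ and all $a\in N_{w'}$ there is $v\in a(w')$ with $v\Vdash\phi$. $\Gamma\Vdash^{\mathrm{inm}}\phi$: in every such model, every world satisfying all of $\Gamma$ satisfies $\phi$. $\mathsf{IFOM}$-structures: $\mathfrak{M}=(W,\le,\mathcal{I})$ with $(W,\le)$ a poset and, for each $w$, sets $\mathcal{I}(\mathsf{s},w),\mathcal{I}(\mathsf{n},w)$, relations $\mathcal{I}(\mathsf{N},w)\subseteq\mathcal{I}(\mathsf{s},w)\times\mathcal{I}(\mathsf{n},w)$, $\mathcal{I}(\mathsf{E},w)\subseteq\mathcal{I}(\mathsf{n},w)\times\mathcal{I}(\mathsf{s},w)$, $\mathcal{I}(P_i,w)\subseteq\mathcal{I}(\mathsf{s},w)$, all increasing along $\le$. Evaluation at $(w,x)$ with $x\in\mathcal{I}(\mathsf{s},w)$: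 $w,x\models p_i$ iff $x\in\mathcal{I}(P_i,w)$; $\bot$ never; $\wedge,\vee$ pointwise; $w,x\models\phi\to\psi$ iff for all $w'\ge w$, $w',x\models\phi$ implies $w',x\models\psi$; $w,x\models\Box\phi$ iff there is $a\in\mathcal{I}(\mathsf{n},w)$ with $(x,a)\in\mathcal{I}(\mathsf{N},w)$ such that for all $w'\ge w$, $x'\in\mathcal{I}(\mathsf{s},w')$ with $(a,x')\in\mathcal{I}(\mathsf{E},w')$, $w',x'\models\phi$; $w,x\models\Diamond\phi$ iff for all $w'\ge w$ and $a'\in\mathcal{I}(\mathsf{n},w')$ with $(x,a')\in\mathcal{I}(\mathsf{N},w')$ there is $y'\in\mathcal{I}(\mathsf{s},w')$ with $(a',y')\in\mathcal{I}(\mathsf{E},w')$ and $w',y'\models\phi$. $\Gamma\models\phi$: for all $\mathsf{IFOM}$-structures and pairs $(w,x)$, satisfying all of $\Gamma$ implies satisfying $\phi$. *)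

(* Defs.v *)
From Stdlib Require Import Ensembles Relations.

Set Implicit Arguments.
Unset Strict Implicit.

(** * Formulas *)

Inductive form : Type :=
| Var (i : nat)
| Bot
| And (phi psi : form)
| Or (phi psi : form)
| Imp (phi psi : form)
| Box (phi : form)
| Dia (phi : form).

Definition Neg (phi : form) : form := Imp phi Bot.
Definition Top : form := Neg Bot.

Fixpoint subst (sigma : nat -> form) (phi : form) : form :=
  match phi with
  | Var i => sigma i
  | Bot => Bot
  | And a b => And (subst sigma a) (subst sigma b)
  | Or a b => Or (subst sigma a) (subst sigma b)
  | Imp a b => Imp (subst sigma a) (subst sigma b)
  | Box a => Box (subst sigma a)
  | Dia a => Dia (subst sigma a)
  end.

(** * The calculus *)

(* A Hilbert-style axiomatisation of intuitionistic propositional logic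
   (complete with modus ponens), in the letters p_0, p_1, p_2. *)
Inductive ipc_axiom : Ensemble form :=
| ipc_K : ipc_axiom (Imp (Var 0) (Imp (Var 1) (Var 0)))
| ipc_S : ipc_axiom
    (Imp (Imp (Var 0) (Imp (Var 1) (Var 2)))
         (Imp (Imp (Var 0) (Var 1)) (Imp (Var 0) (Var 2))))
| ipc_and_l : ipc_axiom (Imp (And (Var 0) (Var 1)) (Var 0))
| ipc_and_r : ipc_axiom (Imp (And (Var 0) (Var 1)) (Var 1))
| ipc_and_i : ipc_axiom (Imp (Var 0) (Imp (Var 1) (And (Var 0) (Var 1))))
| ipc_or_l : ipc_axiom (Imp (Var 0) (Or (Var 0) (Var 1)))
| ipc_or_r : ipc_axiom (Imp (Var 1) (Or (Var 0) (Var 1)))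
| ipc_or_e : ipc_axiom
    (Imp (Imp (Var 0) (Var 2))
         (Imp (Imp (Var 1) (Var 2)) (Imp (Or (Var 0) (Var 1)) (Var 2))))
| ipc_bot : ipc_axiom (Imp Bot (Var 0)).

Inductive modal_axiom : Ensemble form :=
| modal_neg : modal_axiom
    (Imp (And (Box (Var 0)) (Dia (Neg (Var 0)))) Bot)
| modal_int : modal_axiom (Imp (Imp (Box Top) (Dia (Var 0))) (Dia (Var 0))).

Definition Ax : Ensemble form := fun phi =>
  exists (alpha : form) (sigma : nat -> form),
    (ipc_axiom alpha \/ modal_axiom alpha) /\ phi = subst sigma alpha.

Inductive derives : Ensemble form -> form -> Prop :=
| d_El (Gamma : Ensemble form) (phi : form) :
    In form Gamma phi -> derives Gamma phi
| d_Ax (Gamma : Ensemble form) (psi : form) :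
    In form Ax psi -> derives Gamma psi
| d_MP (Gamma : Ensemble form) (phi psi : form) :
    derives Gamma phi -> derives Gamma (Imp phi psi) -> derives Gamma psi
| d_MonBox (Gamma : Ensemble form) (phi psi : form) :
    derives (Empty_set form) (Imp phi psi) ->
    derives Gamma (Imp (Box phi) (Box psi))
| d_MonDia (Gamma : Ensemble form) (phi psi : form) :
    derives (Empty_set form) (Imp phi psi) ->
    derives Gamma (Imp (Dia phi) (Dia psi)).

(** * Intuitionistic neighbourhood models *)

Definition upset (W : Type) (le : relation W) (X : Ensemble W) : Prop :=
  forall w w' : W, le w w' -> In W X w -> In W X w'.

(* Partial functions from W to the powerset of W; [None] means undefined. *)
Definition pfun (W : Type) : Type := W -> option (Ensemble W).

Definition dom (W : Type) (a : pfun W) : Ensemble W :=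
  fun w => exists X : Ensemble W, a w = Some X.

(* [val a w] is a(w); the junk value at [None] is never used below, since
   [val] is only applied at worlds in the domain of [a]. *)
Definition val (W : Type) (a : pfun W) (w : W) : Ensemble W :=
  match a w with
  | Some X => X
  | None => Empty_set W
  end.

Definition int_nbhd (W : Type) (le : relation W) (a : pfun W) : Prop :=
  upset le (dom a).

Record inm_model : Type := INM {
  world : Type;
  wle : relation world;
  wle_order : order world wle;
  nbhds : Ensemble (pfun world);
  nbhds_int : forall a, In _ nbhds a -> int_nbhd wle a;
  valuation : nat -> Ensemble world;
  valuation_upset : forall i, upset wle (valuation i)
}.

Arguments nbhds M : clear implicits, rename.
Arguments valuation M i : clear implicits, rename.

Definition nbhds_at (M : inm_model) (w : world M) : Ensemble (pfun (world M)) :=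
  fun a => In _ (nbhds M) a /\ In _ (dom a) w.

Fixpoint forces (M : inm_model) (w : world M) (phi : form) : Prop :=
  match phi with
  | Var i => In _ (valuation M i) w
  | Bot => False
  | And a b => forces w a /\ forces w b
  | Or a b => forces w a \/ forces w b
  | Imp a b => forall v, wle w v -> forces v a -> forces v b
  | Box b =>
      exists a, In _ (nbhds_at w) a /\
        forall w', wle w w' -> forall v, In _ (val a w') v -> forces v b
  | Dia b =>
      forall w', wle w w' -> forall a, In _ (nbhds_at w') a ->
        exists v, In _ (val a w') v /\ forces v b
  end.

Definition inm_consequence (Gamma : Ensemble form) (phi : form) : Prop :=
  forall (M : inm_model) (w : world M),
    (forall gamma, In form Gamma gamma -> forces w gamma) -> forces w phi.

(** * IFOM-structures *)

(* Two-sorted: the sets I(s,w) and I(n,w) are subsets of ambient types [sD] and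
   [nD] that do not depend on the world, so that inclusions along the order
   make sense; no element of these types need exist at any world. *)
Record ifom_structure : Type := IFOM {
  iworld : Type;
  ile : relation iworld;
  ile_order : order iworld ile;
  sD : Type;
  nD : Type;
  I_s : iworld -> Ensemble sD;
  I_n : iworld -> Ensemble nD;
  I_N : iworld -> sD -> nD -> Prop;
  I_E : iworld -> nD -> sD -> Prop;
  I_P : nat -> iworld -> Ensemble sD;
  I_N_sub : forall w x a, I_N w x a -> In _ (I_s w) x /\ In _ (I_n w) a;
  I_E_sub : forall w a x, I_E w a x -> In _ (I_n w) a /\ In _ (I_s w) x;
  I_P_sub : forall i w, Included _ (I_P i w) (I_s w);
  I_s_mono : forall w w', ile w w' -> Included _ (I_s w) (I_s w');
  I_n_mono : forall w w', ile w w' -> Included _ (I_n w) (I_n w');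
  I_N_mono : forall w w', ile w w' -> forall x a, I_N w x a -> I_N w' x a;
  I_E_mono : forall w w', ile w w' -> forall a x, I_E w a x -> I_E w' a x;
  I_P_mono : forall i w w', ile w w' -> Included _ (I_P i w) (I_P i w')
}.

(* Meaningful when [x] is in [I_s w], which every recursive call preserves. *)
Fixpoint sat (M : ifom_structure) (w : iworld M) (x : sD M) (phi : form)
  : Prop :=
  match phi with
  | Var i => In _ (I_P i w) x
  | Bot => False
  | And a b => sat w x a /\ sat w x b
  | Or a b => sat w x a \/ sat w x b
  | Imp a b => forall w', ile w w' -> sat w' x a -> sat w' x b
  | Box b =>
      exists a, In _ (I_n w) a /\ I_N w x a /\
        forall w', ile w w' -> forall x', In _ (I_s w') x' ->
          I_E w' a x' -> sat w' x' b
  | Dia b =>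
      forall w', ile w w' -> forall a', In _ (I_n w') a' -> I_N w' x a' ->
        exists y', In _ (I_s w') y' /\ I_E w' a' y' /\ sat w' y' b
  end.

Definition ifom_consequence (Gamma : Ensemble form) (phi : form) : Prop :=
  forall (M : ifom_structure) (w : iworld M) (x : sD M),
    In _ (I_s w) x ->
    (forall gamma, In form Gamma gamma -> sat w x gamma) -> sat w x phi.

(* Main.v *)
Require Import Defs.
From Stdlib Require Import Ensembles.
From Stdlib Require Import Relations.

(** Soundness goes by induction on derivations, once for each semantics. The propositional axioms
    hold as in Kripke semantics, because truth persists along the order. For the modal axioms, a
    neighbourhood witnessing a box must, by the diamond, contain a point where both a formula and
    its negation hold; and any neighbourhood at which a diamond is tested already witnesses
    [Box Top]. The monotonicity rules preserve validity because their premise, having empty context,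
    holds everywhere. *)

(** [Imp] and [Dia] quantify over all later worlds, so transitivity suffices. For [Box] the same
    neighbourhood serves at [v], its domain being an upset. *)
Lemma forces_persistent (M : inm_model) (phi : form) (w v : world M) :
  wle w v -> forces w phi -> forces v phi.
Proof.
  destruct (wle_order M) as [_ trans _].
  revert w v; induction phi as [i| |a IHa b IHb|a IHa b IHb|a IHa b IHb|b IHb|b IHb];
    simpl; intros w v Hwv H.
  - exact (valuation_upset Hwv H).
  - exact H.
  - destruct H; split; eauto.
  - destruct H; [left|right]; eauto.
  - intros u Hvu; apply H; exact (trans _ _ _ Hwv Hvu).
  - destruct H as [a [[Ha Hdom] Hb]]; exists a; split.
    + split; [exact Ha | exact (nbhds_int Ha Hwv Hdom)].
    + intros u Hvu; apply Hb; exact (trans _ _ _ Hwv Hvu).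
  - intros u Hvu; apply H; exact (trans _ _ _ Hwv Hvu).
Qed.

Lemma sat_persistent (M : ifom_structure) (phi : form) (w v : iworld M) (x : sD M) :
  ile w v -> sat w x phi -> sat v x phi.
Proof.
  destruct (ile_order M) as [_ trans _].
  revert w v x; induction phi as [i| |a IHa b IHb|a IHa b IHb|a IHa b IHb|b IHb|b IHb];
    simpl; intros w v x Hwv H.
  - exact (I_P_mono Hwv H).
  - exact H.
  - destruct H; split; eauto.
  - destruct H; [left|right]; eauto.
  - intros u Hvu; apply H; exact (trans _ _ _ Hwv Hvu).
  - destruct H as [a [Ha [HN Hb]]]; exists a; repeat split.
    + exact (I_n_mono Hwv Ha).
    + exact (I_N_mono Hwv HN).
    + intros u Hvu; apply Hb; exact (trans _ _ _ Hwv Hvu).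
  - intros u Hvu; apply H; exact (trans _ _ _ Hwv Hvu).
Qed.

Lemma forces_Ax (M : inm_model) (w : world M) (phi : form) :
  In form Ax phi -> forces w phi.
Proof.
  destruct (wle_order M) as [refl trans _].
  intros [alpha [sigma [[H|H] ->]]]; destruct H; simpl.
  - intros v _ H0 u Hvu _; exact (forces_persistent _ _ _ _ Hvu H0).
  - intros v _ H0 u Hvu H1 t Hut H2.
    exact (H0 t (trans _ _ _ Hvu Hut) H2 t (refl t) (H1 t Hut H2)).
  - intros v _ [H0 _]; exact H0.
  - intros v _ [_ H1]; exact H1.
  - intros v _ H0 u Hvu H1; split; [exact (forces_persistent _ _ _ _ Hvu H0) | exact H1].
  - intros v _ H0; left; exact H0.
  - intros v _ H1; right; exact H1.
  - intros v _ H0 u Hvu H1 t Hut [H|H].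
    + exact (H0 t (trans _ _ _ Hvu Hut) H).
    + exact (H1 t Hut H).
  - intros v _ [].
  - intros v _ [[a [Ha Hbox]] Hdia].
    destruct (Hdia v (refl v) a Ha) as [u [Hu Hneg]].
    exact (Hneg u (refl u) (Hbox v (refl v) u Hu)).
  - (* A neighbourhood at [u] witnesses [Box Top] there. *)
    intros v _ H u Hvu a Ha.
    refine (H u Hvu _ u (refl u) a Ha).
    exists a; split; [exact Ha | auto].
Qed.

Lemma sat_Ax (M : ifom_structure) (w : iworld M) (x : sD M) (phi : form) :
  In form Ax phi -> sat w x phi.
Proof.
  destruct (ile_order M) as [refl trans _].
  intros [alpha [sigma [[H|H] ->]]]; destruct H; simpl.
  - intros v _ H0 u Hvu _; exact (sat_persistent _ _ _ _ _ Hvu H0).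
  - intros v _ H0 u Hvu H1 t Hut H2.
    exact (H0 t (trans _ _ _ Hvu Hut) H2 t (refl t) (H1 t Hut H2)).
  - intros v _ [H0 _]; exact H0.
  - intros v _ [_ H1]; exact H1.
  - intros v _ H0 u Hvu H1; split; [exact (sat_persistent _ _ _ _ _ Hvu H0) | exact H1].
  - intros v _ H0; left; exact H0.
  - intros v _ H1; right; exact H1.
  - intros v _ H0 u Hvu H1 t Hut [H|H].
    + exact (H0 t (trans _ _ _ Hvu Hut) H).
    + exact (H1 t Hut H).
  - intros v _ [].
  - intros v _ [[a [Ha [HN Hbox]]] Hdia].
    (* Here the contradiction arises at the same world [v], at a new element [y], rather than at a
       new world. *)
    destruct (Hdia v (refl v) a Ha HN) as [y [Hy [HE Hneg]]].
    exact (Hneg v (refl v) (Hbox v (refl v) y Hy HE)).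
  - (* A neighbourhood of [x] at [u] witnesses [Box Top] there. *)
    intros v _ H u Hvu a Ha HN.
    refine (H u Hvu _ u (refl u) a Ha HN).
    exists a; repeat split; auto.
Qed.

Lemma derives_inm_sound (Gamma : Ensemble form) (phi : form) :
  derives Gamma phi -> inm_consequence Gamma phi.
Proof.
  intros D; induction D as [Gamma phi H|Gamma psi H|Gamma phi psi _ IH1 _ IH2
                           |Gamma phi psi _ IH|Gamma phi psi _ IH]; intros M w HG;
    destruct (wle_order M) as [refl _ _].
  - exact (HG _ H).
  - exact (forces_Ax _ _ _ H).
  - exact (IH2 M w HG w (refl w) (IH1 M w HG)).
  (* The empty context makes the premise usable at points inside a neighbourhood, where [Gamma] may
     fail. *)
  - assert (Himp : forall v : world M, forces v phi -> forces v psi)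
      by (intros v; refine (IH M v _ v (refl v)); intros _ []).
    intros v _ [a [Ha Hb]]; exists a; split; [exact Ha | eauto].
  - assert (Himp : forall v : world M, forces v phi -> forces v psi)
      by (intros v; refine (IH M v _ v (refl v)); intros _ []).
    intros v _ H u Hvu a Ha.
    destruct (H u Hvu a Ha) as [t [Ht Hphi]]; exists t; auto.
Qed.

Lemma derives_ifom_sound (Gamma : Ensemble form) (phi : form) :
  derives Gamma phi -> ifom_consequence Gamma phi.
Proof.
  intros D; induction D as [Gamma phi H|Gamma psi H|Gamma phi psi _ IH1 _ IH2
                           |Gamma phi psi _ IH|Gamma phi psi _ IH]; intros M w x Hx HG;
    destruct (ile_order M) as [refl _ _].
  - exact (HG _ H).
  - exact (sat_Ax _ _ _ _ H).
  - exact (IH2 M w x Hx HG w (refl w) (IH1 M w x Hx HG)).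
  (* Consequence speaks only of elements of [I_s]; the modal clauses supply this membership for
     [y]. *)
  - assert (Himp : forall (v : iworld M) y, In _ (I_s v) y -> sat v y phi -> sat v y psi)
      by (intros v y Hy; refine (IH M v y Hy _ v (refl v)); intros _ []).
    intros v _ [a [Ha [HN Hb]]]; exists a; repeat split; eauto.
  - assert (Himp : forall (v : iworld M) y, In _ (I_s v) y -> sat v y phi -> sat v y psi)
      by (intros v y Hy; refine (IH M v y Hy _ v (refl v)); intros _ []).
    intros v _ H u Hvu a Ha HN.
    destruct (H u Hvu a Ha HN) as [y [Hy [HE Hphi]]]; exists y; auto.
Qed.

Theorem theorem3p9 (Gamma : Ensemble form) (phi : form) :
  derives Gamma phi -> inm_consequence Gamma phi /\ ifom_consequence Gamma phi.
Proof.
  intros D; split; [exact (derives_inm_sound _ _ D) | exact (derives_ifom_sound _ _ D)].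
Qed.
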